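(* Let $R$ be an integral domain endowed with a non-Archimedean absolute value $|\cdot|$. If the characteristic of $R$ is not $2$, then the only solutions $(X,Y)$ in $\mathcal{A}_R$ of the Pell equation $$X^2-(t^2-1)Y^2=1$$ are the pairs of polynomials $(\pm x_n,y_n)$, $n\in\mathbb{Z}$, where $x_n,y_n\in R[t]$ are defined by $$x_n+y_n\sqrt{t^2-1}=\big(t+\sqrt{t^2-1}\big)^n.$$ If the characteristic of $R$ is $2$, then the only solutions $(X,Y)$ in $\mathcal{A}_R$ of the equation $$X^2+tXY+Y^2=1$$ are the pairs of polynomials $(x_n,y_n)$, $n\in\mathbb{Z}$, where $x_n,y_n\in R[t]$ are defined by $x_n+y_n\alpha=\alpha^n$, with $\alpha$ a root of $Z^2+tZ+1=0$. In all cases, the polynomials $x_n$ and $y_n$ have coefficients in the sub-ring of $R$ generated by $1$ (that is, $\mathbb{Z}$ or $\mathbb{F}_p$ depending on the characteristic).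
   Context: For an integral domain $R$ with a non-Archimedean absolute value $|\cdot|$ (the trivial absolute value is allowed), the ring of entire functions over $R$ is $$\mathcal{A}_R=\Big\{\sum_{n\ge 0}c_nt^n\in R[[t]] : \forall r\in\mathbb{R}^+,\ \lim_{M\to\infty}|c_M|r^M=0\Big\}\supseteq R[t].$$ *)

(* Defs.v *)
From HB Require Import structures.
From mathcomp Require Import all_boot all_order all_algebra.
From mathcomp Require Import boolp classical_sets functions reals topology.
From mathcomp Require Import normedtype sequences.

Set Implicit Arguments.
Unset Strict Implicit.
Unset Printing Implicit Defensive.

Import Order.TTheory GRing.Theory Num.Theory.
Import numFieldNormedType.Exports.

Local Open Scope classical_set_scope.
Local Open Scope ring_scope.

Record nonarch_absval (K : realType) (R : idomainType) (v : R -> K) : Prop :=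
  NonarchAbsval {
    absval_ge0 : forall x, 0 <= v x;
    absval_eq0 : forall x, v x = 0 <-> x = 0;
    absvalM : forall x y, v (x * y) = v x * v y;
    absvalD_le_max : forall x y, v (x + y) <= Num.max (v x) (v y)
  }.

(* [f n] is the coefficient of t^n; the ring structure is given by the Cauchy
   product, not by the pointwise product that [nat -> R] carries. *)
Definition powerseries (R : Type) : Type := nat -> R.

HB.instance Definition _ (R : zmodType) :=
  GRing.Zmodule.copy (powerseries R) (nat -> R).

Section PowerSeriesRing.
Variable R : comNzRingType.
Implicit Types f g h : powerseries R.

Definition ps_one : powerseries R := fun n => (n == 0%N)%:R.

Definition ps_mul f g : powerseries R :=
  fun n => \sum_(i < n.+1) f i * g (n - i)%N.

Definition ps_trunc n f : {poly R} := \poly_(i < n.+1) f i.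

Lemma ps_trunc_coef n f i : (i <= n)%N -> (ps_trunc n f)`_i = f i.
Proof. by move=> le_in; rewrite coef_poly ltnS le_in. Qed.

Lemma ps_mul_trunc n k f g : (k <= n)%N ->
  ps_mul f g k = (ps_trunc n f * ps_trunc n g)`_k.
Proof.
move=> le_kn; rewrite coefM; apply: eq_bigr => i _.
rewrite !ps_trunc_coef ?(leq_trans (leq_subr _ _)) //.
by rewrite (leq_trans _ le_kn) // -ltnS.
Qed.

Lemma ps_addE f g n : (f + g) n = f n + g n. Proof. by []. Qed.

Lemma ps_mulC : commutative ps_mul.
Proof.
by move=> f g; apply/funext => n; rewrite !(@ps_mul_trunc n) // mulrC.
Qed.

Lemma ps_mulA : associative ps_mul.
Proof.
move=> f g h; apply/funext => n.
transitivity ((ps_trunc n f * (ps_trunc n g * ps_trunc n h))`_n).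
  rewrite coefM; apply: eq_bigr => i _.
  have le_in : (i <= n)%N by rewrite -ltnS.
  by rewrite ps_trunc_coef // -ps_mul_trunc ?leq_subr.
rewrite mulrA coefM; apply: eq_bigr => i _.
have le_in : (i <= n)%N by rewrite -ltnS.
by rewrite ps_trunc_coef ?leq_subr // -ps_mul_trunc.
Qed.

Lemma ps_mul1 : left_id ps_one ps_mul.
Proof.
move=> f; apply/funext => n; rewrite /ps_mul big_ord_recl subn0 mul1r.
by rewrite big1 ?addr0 // => i _; rewrite mul0r.
Qed.

Lemma ps_mulDl : left_distributive ps_mul +%R.
Proof.
move=> f g h; apply/funext => n; rewrite ps_addE -big_split /=.
by apply: eq_bigr => i _; rewrite ps_addE mulrDl.
Qed.

Lemma ps_one_neq0 : ps_one != 0.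
Proof.
by apply/eqP => /(congr1 (fun f : powerseries R => f 0%N)) /eqP;
   rewrite oner_eq0.
Qed.

HB.instance Definition _ := GRing.Zmodule_isComNzRing.Build (powerseries R)
  ps_mulA ps_mulC ps_mul1 ps_mulDl ps_one_neq0.

Definition poly_series (p : {poly R}) : powerseries R := fun n => p`_n.

Lemma poly_series_is_zmod_morphism : zmod_morphism poly_series.
Proof. by move=> p q; apply/funext => n; rewrite /poly_series coefB. Qed.

Lemma poly_series_is_monoid_morphism : monoid_morphism poly_series.
Proof.
by split=> [|p q]; apply/funext => n; rewrite /poly_series ?coef1 ?coefM.
Qed.

HB.instance Definition _ := GRing.isZmodMorphism.Build
  {poly R} (powerseries R) poly_series poly_series_is_zmod_morphism.
HB.instance Definition _ := GRing.isMonoidMorphism.Build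
  {poly R} (powerseries R) poly_series poly_series_is_monoid_morphism.

Lemma poly_series_inj : injective poly_series.
Proof. by move=> p q pq; apply/polyP => n; move/(congr1 (@^~ n)): pq. Qed.

End PowerSeriesRing.

Definition entire (K : realType) (R : idomainType) (v : R -> K) :
    set (powerseries R) :=
  [set f | forall r : K, 0 < r -> (fun M => v (f M) * r ^+ M) @ \oo --> (0 : K)].

Lemma entire_poly (K : realType) (R : idomainType) (v : R -> K)
    (hv : nonarch_absval v) (p : {poly R}) : entire v (poly_series p).
Proof.
move=> r r_gt0; apply: cvg_near_cst; exists (size p) => // n /= le_pn.
by rewrite /poly_series nth_default // (absval_eq0 hv 0).2 ?mul0r.
Qed.

(* A[Z]/(h). This is {poly %/ h} with a unit ring structure for every
   commutative ring A, so that integer powers z ^ n are available; the library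
   only has one when A is a field. *)
Definition adjoin_root (A : comNzRingType) (h : {poly A}) : Type :=
  {poly %/ h}.

Section AdjoinRoot.
Variables (A : comNzRingType) (h : {poly A}).

HB.instance Definition _ := GRing.ComNzRing.copy (adjoin_root h) {poly %/ h}.

Definition ar_unit : {pred adjoin_root h} :=
  fun z => `[< exists w, w * z = 1 >].

Definition ar_inv (z : adjoin_root h) : adjoin_root h :=
  if pselect (exists w, w * z = 1) is left ex then projT1 (cid ex) else z.

Lemma ar_mulVz : {in ar_unit, left_inverse 1 ar_inv *%R}.
Proof.
move=> z /asboolP zU; rewrite /ar_inv; case: pselect => // ex.
exact: projT2 (cid ex).
Qed.

Lemma ar_unitPl z w : w * z = 1 -> ar_unit z.
Proof. by move=> wz; apply/asboolP; exists w. Qed.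

Lemma ar_inv_out : {in [predC ar_unit], ar_inv =1 id}.
Proof. by move=> z /asboolPn nzU; rewrite /ar_inv; case: pselect. Qed.

HB.instance Definition _ := GRing.ComNzRing_hasMulInverse.Build
  (adjoin_root h) ar_mulVz ar_unitPl ar_inv_out.

Definition ar_const (a : A) : adjoin_root h := qpolyC h a.

Definition ar_root : adjoin_root h := in_qpoly h 'X.

Lemma ar_const_is_zmod_morphism : zmod_morphism ar_const.
Proof. exact: (rmorphB (qpolyC h)). Qed.

Lemma ar_const_is_monoid_morphism : monoid_morphism ar_const.
Proof. by split; [exact: (rmorph1 (qpolyC h)) | exact: (rmorphM (qpolyC h))]. Qed.

HB.instance Definition _ := GRing.isZmodMorphism.Build
  A (adjoin_root h) ar_const ar_const_is_zmod_morphism.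
HB.instance Definition _ := GRing.isMonoidMorphism.Build
  A (adjoin_root h) ar_const ar_const_is_monoid_morphism.

Lemma ar_constE (a : A) : ar_const a = in_qpoly h a%:P.
Proof.
apply/esym/val_inj; rewrite [LHS]in_qpoly_small //.
exact: leq_ltn_trans (size_polyC_leq1 _) (size_mk_monic_gt1 h).
Qed.

(* The k-th coordinate in the basis 1, root, root^2, ... *)
Definition ar_coord (k : nat) (z : adjoin_root h) : A :=
  ((z : {poly %/ h}) : {poly A})`_k.

Hypotheses (h_monic : h \is monic) (sz_h : size h = 3).

Lemma mk_monic_quad : mk_monic h = h.
Proof. by rewrite /mk_monic sz_h h_monic. Qed.

Lemma in_qpoly_modulus : in_qpoly h h = 0.
Proof.
by apply: val_inj; rewrite /= mk_monic_quad; exact: Pdiv.RingMonic.rmodpp.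
Qed.

Lemma in_qpoly_lin (a b : A) :
  in_qpoly h (a%:P + b%:P * 'X) = a%:P + b%:P * 'X :> {poly A}.
Proof.
rewrite in_qpoly_small // mk_monic_quad sz_h addrC size_MXaddC.
by case: ifP => // _; rewrite ltnS ltnS size_polyC_leq1.
Qed.

Lemma ar_linE (a b : A) :
  ar_const a + ar_const b * ar_root = in_qpoly h (a%:P + b%:P * 'X).
Proof.
by rewrite !ar_constE raddfD /= in_qpolyM.
Qed.

Lemma ar_decomp (z : adjoin_root h) :
  ar_const (ar_coord 0 z) + ar_const (ar_coord 1 z) * ar_root = z.
Proof.
rewrite ar_linE; apply: val_inj; rewrite [LHS]in_qpoly_lin.
have szz : (size (z : {poly A}) <= 2)%N.
  have := leq_trans (size_mk_monic (z : {poly %/ h}))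
                    (eq_leq (congr1 (fun p : {poly A} => size p) mk_monic_quad)).
  by rewrite /= sz_h ltnS.
apply/polyP => -[|[|i]]; rewrite coefD coefC coefCM coefX /=.
- by rewrite mulr0 addr0.
- by rewrite mulr1 add0r.
by rewrite mulr0 addr0 nth_default // (leq_trans szz).
Qed.

Lemma ar_coord_unique (a b : A) (z : adjoin_root h) :
  ar_const a + ar_const b * ar_root = z -> a = ar_coord 0 z /\ b = ar_coord 1 z.
Proof.
move=> <-; rewrite ar_linE /ar_coord in_qpoly_lin.
by rewrite !coefD !coefC !coefCM !coefX /= mulr0 mulr1 addr0 add0r.
Qed.

End AdjoinRoot.

(* {poly R} is R[t], so that in {poly {poly R}} the inner variable t is ('X)%:P
   and the outer variable Z is 'X. *)

Section Pell.
Variable R : idomainType.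

(* Z^2 - (t^2 - 1) *)
Definition pell_poly : {poly {poly R}} := 'X^2 - ('X^2 - 1)%:P.

(* t + sqrt (t^2 - 1) *)
Definition pell_unit : adjoin_root pell_poly :=
  ar_const pell_poly 'X + ar_root pell_poly.

Definition pell_x (n : int) : {poly R} := ar_coord 0 (pell_unit ^ n).
Definition pell_y (n : int) : {poly R} := ar_coord 1 (pell_unit ^ n).

(* Z^2 + t Z + 1 *)
Definition pell2_poly : {poly {poly R}} := 'X^2 + ('X)%:P * 'X + 1.

Definition pell2_root : adjoin_root pell2_poly := ar_root pell2_poly.

Definition pell2_x (n : int) : {poly R} := ar_coord 0 (pell2_root ^ n).
Definition pell2_y (n : int) : {poly R} := ar_coord 1 (pell2_root ^ n).

Lemma pell_poly_size : size pell_poly = 3%N.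
Proof.
rewrite /pell_poly -polyCN size_polyDl size_polyXn //.
exact: leq_ltn_trans (size_polyC_leq1 _) _.
Qed.

Lemma pell_poly_monic : pell_poly \is monic.
Proof.
rewrite monicE /pell_poly -polyCN lead_coefDl ?lead_coefXn // size_polyXn.
exact: leq_ltn_trans (size_polyC_leq1 _) _.
Qed.

Lemma pell2_tail_size : (size ('X%:P * 'X + 1 : {poly {poly R}})%R < 3)%N.
Proof.
by rewrite -[1 in X in size X]polyC1 size_MXaddC; case: ifP => // _;
   rewrite ltnS ltnS size_polyC_leq1.
Qed.

Lemma pell2_poly_size : size pell2_poly = 3%N.
Proof.
by rewrite /pell2_poly -addrA size_polyDl size_polyXn // pell2_tail_size.
Qed.

Lemma pell2_poly_monic : pell2_poly \is monic.
Proof.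
by rewrite monicE /pell2_poly -addrA lead_coefDl ?lead_coefXn // size_polyXn
   pell2_tail_size.
Qed.

Lemma pell_rootE :
  ar_root pell_poly ^+ 2 = ar_const pell_poly ('X^2 - 1).
Proof.
apply/eqP; rewrite -subr_eq0 ar_constE expr2 -[ar_root _ * _]in_qpolyM -expr2.
apply/eqP; rewrite -[LHS](raddfB (in_qpoly pell_poly)).
exact: in_qpoly_modulus pell_poly_monic pell_poly_size.
Qed.

Lemma pell_unitP : pell_unit \is a GRing.unit.
Proof.
apply/unitrPr; exists (ar_const pell_poly 'X - ar_root pell_poly).
rewrite /pell_unit mulrC -subr_sqr pell_rootE -rmorphXn -rmorphB opprB.
by rewrite addrC subrK rmorph1.
Qed.

Lemma pell_xyE n :
  ar_const pell_poly (pell_x n) +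
    ar_const pell_poly (pell_y n) * ar_root pell_poly = pell_unit ^ n.
Proof. exact: ar_decomp pell_poly_monic pell_poly_size _. Qed.

Lemma pell2_rootE :
  pell2_root ^+ 2 + ar_const pell2_poly 'X * pell2_root + 1 = 0.
Proof.
rewrite ar_constE expr2 -[pell2_root * _]in_qpolyM -expr2.
rewrite -[in_qpoly _ _ * _]in_qpolyM -[1](in_qpoly1 pell2_poly).
rewrite -[X in X + _ = _](raddfD (in_qpoly pell2_poly)).
rewrite -[LHS](raddfD (in_qpoly pell2_poly)).
exact: in_qpoly_modulus pell2_poly_monic pell2_poly_size.
Qed.

Lemma pell2_rootP : pell2_root \is a GRing.unit.
Proof.
apply/unitrPr; exists (- (pell2_root + ar_const pell2_poly 'X)).
have /eqP := pell2_rootE; rewrite addr_eq0 => /eqP e.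
by rewrite mulrN mulrDr [_ * ar_const _ _]mulrC -expr2 e opprK.
Qed.

Lemma pell2_xyE n :
  ar_const pell2_poly (pell2_x n) +
    ar_const pell2_poly (pell2_y n) * pell2_root = pell2_root ^ n.
Proof. exact: ar_decomp pell2_poly_monic pell2_poly_size _. Qed.

End Pell.

Definition prime_subring (R : nzRingType) : set R :=
  smallest (fun S : set R => subring_closed (mem S)) [set 1].
Arguments prime_subring : clear implicits.

Lemma prime_subringE (R : nzRingType) :
  prime_subring R = range (fun m : int => m%:~R : R).
Proof.
apply/seteqP; split=> [|_ [m _ <-]].
  apply: smallest_sub => [|_ ->]; last by exists 1.
  split=> [|x y /set_mem[m _ <-] /set_mem[n _ <-]
           |x y /set_mem[m _ <-] /set_mem[n _ <-]]; apply/mem_set.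
  - by exists 1.
  - by exists (m - n); rewrite // intrB.
  - by exists (m * n); rewrite // intrM.
move=> S [[S1 SB SM] _].
have S0 : 0 \in S by rewrite -(subrr (1 : R)) SB.
have SN (k : nat) : k%:R \in S.
  elim: k => // k IH.
  by rewrite mulrS -[k%:R]opprK SB // -[- _]add0r SB.
by apply/set_mem; case: m => k; rewrite ?NegzE ?mulrNz -pmulrn ?SN //
  -[- _]add0r SB.
Qed.

(* With prime_subringE, these identify it with Z, respectively with Z/pZ. *)
Lemma prime_subring_pchar0 (R : idomainType) :
  [pchar R] =i pred0 -> injective (fun m : int => m%:~R : R).
Proof.
move=> charR m n /eqP; rewrite -subr_eq0 -intrB => /eqP mn0.
apply/eqP; rewrite -subr_eq0; move: (m - n) mn0 => k k0.
have kR0 : (`|k|%N)%:R = 0 :> R.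
  case: k k0 => // k; rewrite NegzE mulrNz => /eqP.
  by rewrite oppr_eq0 => /eqP.
by rewrite -absz_eq0 -((pcharf0P R).1 charR) kR0.
Qed.

Lemma prime_subring_pchar (R : nzRingType) (p : nat) (m n : int) :
  p \in [pchar R] -> (m%:~R = n%:~R :> R) <-> (m = n %[mod p])%Z.
Proof.
move=> charR; split=> [/eqP|/eqP].
  rewrite -subr_eq0 -intrB => mn0; apply/eqP; rewrite eqz_mod_dvd.
  move: (m - n) mn0 => k k0; rewrite dvdzE /= (dvdn_pcharf charR).
  by case: k k0 => // k; rewrite NegzE mulrNz oppr_eq0.
rewrite eqz_mod_dvd => /dvdzP[k mnE]; apply/eqP.
by rewrite -subr_eq0 -intrB mnE intrM [p%:~R](pcharf0 charR) mulr0.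
Qed.

(* Main.v *)
Require Import Defs.
From mathcomp Require Import all_boot all_order all_algebra.
From mathcomp Require Import boolp classical_sets functions reals topology.
From mathcomp Require Import normedtype sequences.
From mathcomp Require Import ring zify.

Set Implicit Arguments.
Unset Strict Implicit.
Unset Printing Implicit Defensive.

Import Order.TTheory GRing.Theory Num.Theory.
Import numFieldNormedType.Exports.
Local Open Scope ring_scope.

(** Both equations say that some A + B u has norm 1, where u^2 = c t u - 1 with
    c a nonzero constant: the norm of A + B u is A^2 + c t A B + B^2.  For the
    Pell equation u = t + sqrt (t^2 - 1), c = 2 and X = A + t B, Y = B; in
    characteristic 2, c = -1 and u is the root alpha itself.  Multiplying
    A + B u by the powers of u produces one two-sided sequence C with
    C_0 = -A and C_1 = B, (A + B u) u^n = - C_n + C_(n+1) u, and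
<<
      C_(n+1) + C_(n-1) = c t C_n,     C_n^2 - C_(n-1) C_(n+1) = 1.
>>
    Everything follows from the sizes g_n = |C_n|_r of its terms for the Gauss
    norm |f|_r = sup_k |f_k| r^k, which is an ultrametric multiplicative norm
    on entire functions (gaussD, gaussM).  When s = |c| r > 1 the two relations
    become
<<
      s g_n <= max (g_(n-1), g_(n+1)),
      g_(n-1) g_(n+1) <= max (g_n^2, 1),   1 <= max (g_n^2, g_(n-1) g_(n+1)).
>>
    These alone force two consecutive g's to be at most 1
    (growth_le1_exists), by a descent moving along the sequence towards its
    smaller end, which divides the bound on the sizes by s at each step; and
    the index where this happens is determined up to 1 (growth_le1_close).

    The Gauss norm increases with r, so a pair that is small at a large radius
    is small at every smaller one.  As only three indices are candidates, one
    index n serves for all large r, and then C_n and C_(n+1) are constants a, b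
    with a^2 - c t a b + b^2 = 1.  Hence a b = 0, and up to a sign and a shift
    of the index the sequence is the one that starts with 0, 1, which consists
    of the coordinates of the powers of u.  For the Pell equation conjugation,
    which inverts u, absorbs the sign of Y; in characteristic 2 signs vanish.

    For the trivial absolute value entire functions are polynomials and the
    argument reads as a comparison of degrees. *)

(** * Two-sided sequences with C (n + 1) + C (n - 1) = tau * C n *)

Lemma int_step_ind (P : int -> Prop) :
  P 0 -> (forall n, P n -> P (n + 1)) -> (forall n, P n -> P (n - 1)) ->
  forall n, P n.
Proof.
move=> P0 PS PB; elim/int_rect=> // n Pn.
  by rewrite -addn1 PoszD; exact: PS.
by rewrite -addn1 PoszD opprD; exact: PB.
Qed.

(** The recurrence of the Chebyshev polynomials, which are the solutions for
    tau = 2 t; it is satisfied by the coordinates of z * u ^ n whenever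
    u ^ 2 = tau * u - 1. *)
Definition chebyshev_rec (E : comNzRingType) (tau : E) (C : int -> E) : Prop :=
  forall n, C (n + 1) + C (n - 1) = tau * C n.

Section ChebyshevRec.
Variables (E : comNzRingType) (tau : E).
Implicit Types C D : int -> E.

Lemma chebyshev_recS C n : chebyshev_rec tau C ->
  C (n + 1 + 1) = tau * C (n + 1) - C n.
Proof. by move=> rC; rewrite -rC addrK addrK. Qed.

Lemma chebyshev_recP C n : chebyshev_rec tau C ->
  C (n - 1) = tau * C n - C (n + 1).
Proof. by move=> rC; rewrite -rC [C _ + _]addrC addrK. Qed.

Lemma chebyshev_rec_shift C m : chebyshev_rec tau C ->
  chebyshev_rec tau (fun n => C (n + m)).
Proof. by move=> rC n; rewrite -rC (addrAC n 1) (addrAC n (- 1)). Qed.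

Lemma chebyshev_rec_opp C : chebyshev_rec tau C ->
  chebyshev_rec tau (fun n => C (- n)).
Proof. by move=> rC n; rewrite -rC addrC; congr (C _ + C _); lia. Qed.

Lemma chebyshev_rec_comb C D a b : chebyshev_rec tau C ->
  chebyshev_rec tau D -> chebyshev_rec tau (fun n => a * C n + b * D n).
Proof.
move=> rC rD n.
transitivity (a * (C (n + 1) + C (n - 1)) + b * (D (n + 1) + D (n - 1))).
  by ring.
by rewrite rC rD; ring.
Qed.

Lemma chebyshev_rec_ind C (P : E -> Prop) : chebyshev_rec tau C ->
  P (C 0) -> P (C 1) -> (forall a b, P a -> P b -> P (tau * a - b)) ->
  forall n, P (C n).
Proof.
move=> rC P0 P1 PS n; suff: P (C n) /\ P (C (n + 1)) by case.
elim/int_step_ind: n => [|n [Pn Pn1]|n [Pn Pn1]]; first by rewrite add0r.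
  by split; rewrite // chebyshev_recS //; exact: PS.
by rewrite subrK; split; rewrite // chebyshev_recP //; exact: PS.
Qed.

Lemma chebyshev_rec_uniq C D : chebyshev_rec tau C ->
  chebyshev_rec tau D -> C 0 = D 0 -> C 1 = D 1 -> C =1 D.
Proof.
move=> rC rD e0 e1 n; apply/eqP; rewrite -subr_eq0; apply/eqP.
have /chebyshev_rec_ind := chebyshev_rec_comb 1 (-1) rC rD.
move=> /(_ (fun x => x = 0)); rewrite e0 e1 !mul1r !mulN1r !subrr.
move=> /(_ erefl erefl _ n); rewrite mul1r mulN1r; apply.
by move=> a b -> ->; rewrite mulr0 subrr.
Qed.

(** The left-hand side is the norm of - C n + C (n + 1) * u, and u has
    norm 1. *)
Lemma chebyshev_rec_norm C n : chebyshev_rec tau C ->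
  C n ^+ 2 - tau * C n * C (n + 1) + C (n + 1) ^+ 2 =
  C 0 ^+ 2 - tau * C 0 * C 1 + C 1 ^+ 2.
Proof.
move=> rC; elim/int_step_ind: n => [|n <-|n <-]; first by rewrite add0r.
  by rewrite chebyshev_recS //; ring.
by rewrite subrK chebyshev_recP //; ring.
Qed.

End ChebyshevRec.

(** * Nonnegative sequences that grow in both directions *)

Section Growth.
Variables (K : realType) (s : K) (g : int -> K).
Hypotheses (s_gt1 : 1 < s) (g_ge0 : forall n, 0 <= g n).
Hypothesis g_convex :
  forall n, s * g n <= Num.max (g (n - 1)) (g (n + 1)).
Hypothesis g_mul :
  forall n, g (n - 1) * g (n + 1) <= Num.max (g n ^+ 2) 1.
Hypothesis g_unit :
  forall n, 1 <= Num.max (g n ^+ 2) (g (n - 1) * g (n + 1)).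

Let s_gt0 : 0 < s. Proof. exact: lt_trans s_gt1. Qed.

Lemma expr_unbounded (M : K) : exists N, M <= s ^+ N.
Proof.
have : `|s^-1| < 1 by rewrite ger0_norm ?invr_ge0 ?ltW // invf_lt1.
move=> /(cvg_geometric M) cvg0.
have [N _ /(_ N (leqnn N))] := (cvgr0Pnorm_lt (geometric M s^-1)).1 cvg0 1 ltr01.
rewrite /geometric /= exprVn => /ltW h; exists N.
rewrite -[leRHS]mul1r -ler_pdivrMr ?exprn_gt0 //.
exact: le_trans (ler_norm _) h.
Qed.

(** One step of the descent: x, a, b are three consecutive sizes, read in
    either direction, with a <= b <= s * T; moving one place towards x brings
    the bound down to T.  The relation on x * b first
    gives x <= b, whence a <= b / s by the convexity relation, and then used
    again with this better bound on a it gives x <= T. *)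
Lemma descent_step (x a b T : K) : 0 <= a -> 1 <= T -> b <= s * T ->
  1 < b -> a <= b -> x * b <= Num.max (a ^+ 2) 1 -> s * a <= Num.max x b ->
  a <= T /\ x <= T.
Proof.
move=> a0 T1 bT b1 ab xb sa.
have b_gt0 : 0 < b by exact: lt_trans b1.
have xleb : x <= b.
  rewrite -(ler_pM2r b_gt0) (le_trans xb) // ge_max; apply/andP; split.
    by rewrite expr2 ler_pM.
  by rewrite -expr2 exprn_ege1 // ltW.
have {sa} aT : a <= T.
  rewrite -(ler_pM2l s_gt0) (le_trans _ bT) // (le_trans sa) //.
  by rewrite ge_max xleb lexx.
split=> //; rewrite -(ler_pM2r b_gt0) (le_trans xb) // ge_max; apply/andP.
split; first by rewrite expr2 ler_pM.
by rewrite (le_trans (ltW b1)) // ler_peMl // ltW.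
Qed.

Lemma growth_le1_exists : exists n, g n <= 1 /\ g (n + 1) <= 1.
Proof.
suff H N : forall n, g n <= s ^+ N -> g (n + 1) <= s ^+ N ->
    exists m, g m <= 1 /\ g (m + 1) <= 1.
  have [N] := expr_unbounded (Num.max (g 0) (g (0 + 1))).
  by rewrite ge_max => /andP[h0 h1]; exact: H h0 h1.
elim: N => [|N IH] n; first by rewrite expr0; exists n.
rewrite exprS => ha hb.
have T1 : 1 <= s ^+ N by rewrite exprn_ege1 // ltW.
have := g_convex n; have := g_convex (n + 1).
have := g_mul n; have := g_mul (n + 1); rewrite addrK => mb ma cb ca.
have [lab|/ltW lab] := leP (g n) (g (n + 1)).
  have [b1|b1] := leP (g (n + 1)) 1; first by exists n; rewrite (le_trans lab).
  have [aT xT] := descent_step (g_ge0 n) T1 hb b1 lab ma ca.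
  by apply: (IH (n - 1)); rewrite ?subrK.
have [b1|b1] := leP (g n) 1; first by exists n; rewrite (le_trans lab).
rewrite mulrC in mb; rewrite maxC in cb.
have [aT xT] := descent_step (g_ge0 (n + 1)) T1 ha b1 lab mb cb.
exact: (IH (n + 1)).
Qed.

(** By the convexity relation, a strict ascent can only continue. *)
Lemma growth_stays_gt1 n : g n <= 1 -> 1 < g (n + 1) ->
  forall k : nat, 1 < g (n + 1 + k).
Proof.
move=> gn gn1.
suff H (k : nat) : g (n + k) < g (n + 1 + k) /\ 1 < g (n + 1 + k).
  by move=> k; case: (H k).
elim: k => [|k [lt_k gt1_k]]; first by rewrite !addr0 (le_lt_trans gn gn1).
have -> : n + k.+1 = n + 1 + k by lia.
have -> : n + 1 + k.+1 = n + 1 + k + 1 by lia.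
suff h : g (n + 1 + k) < g (n + 1 + k + 1) by rewrite h (lt_trans gt1_k h).
have := g_convex (n + 1 + k).
have -> : n + 1 + k - 1 = n + k by lia.
rewrite le_max => /orP; have : g (n + 1 + k) < s * g (n + 1 + k).
  by rewrite ltr_pMl // (lt_trans _ gt1_k).
move=> h [h2|]; last exact: lt_le_trans.
by have := lt_trans lt_k (lt_le_trans h h2); rewrite ltxx.
Qed.

(** Were n >= m + 2, then by growth_stays_gt1 the four sizes from m to m + 3
    would all be at most 1; by convexity the middle two would be at most
    s^-1 < 1, against 1 <= max (g_(m+1)^2, g_m g_(m+2)). *)
Lemma growth_le1_close m n : g m <= 1 -> g (m + 1) <= 1 ->
  g n <= 1 -> g (n + 1) <= 1 -> n <= m + 1.
Proof.
move=> m0 m1 n0 n1; rewrite leNgt; apply/negP => lt_mn.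
have stay k l : g k <= 1 -> g l <= 1 -> k + 1 <= l -> g (k + 1) <= 1.
  move=> gk gl le_kl; rewrite leNgt; apply/negP => /(growth_stays_gt1 gk).
  move=> /(_ (absz (l - (k + 1))%R)).
  rewrite (_ : k + 1 + Posz _ = l); last by lia.
  by move: gl => /le_lt_trans/[apply]; rewrite ltxx.
have m2 : g (m + 1 + 1) <= 1 by apply: stay n0 _ => //; lia.
have m3 : g (m + 1 + 1 + 1) <= 1 by apply: stay n1 _ => //; lia.
have small k : g (k - 1) <= 1 -> g (k + 1) <= 1 -> g k <= s^-1.
  move=> h1 h2; rewrite -div1r ler_pdivlMr // mulrC (le_trans (g_convex k)) //.
  by rewrite ge_max h1 h2.
have sV1 : s^-1 < 1 by rewrite invf_lt1.
have g1 : g (m + 1) <= s^-1 by apply: small; rewrite ?addrK.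
have g2 : g (m + 1 + 1) <= s^-1 by apply: small; rewrite ?addrK.
have := g_unit (m + 1); rewrite addrK le_max; apply/negP.
rewrite negb_or -!ltNge; apply/andP; split.
  by rewrite expr_lt1 // (le_lt_trans g1).
rewrite -[X in _ < X]mul1r (le_lt_trans _ (_ : 1 * s^-1 < _)) //.
  exact: ler_pM.
by rewrite !mul1r.
Qed.

End Growth.

(** * The Gauss norm of an entire function *)

Section GaussNorm.
Variables (K : realType) (R : idomainType) (v : R -> K).
Hypothesis hv : nonarch_absval v.
Implicit Types (f g : powerseries R) (r : K).

Lemma absval0 : v 0 = 0. Proof. exact: (absval_eq0 hv 0).2. Qed.

Lemma absval_gt0 x : (0 < v x) = (x != 0).
Proof.
rewrite lt_def (absval_ge0 hv) andbT; congr negb.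
by apply/eqP/eqP => /(absval_eq0 hv).
Qed.

Lemma absval1 : v 1 = 1.
Proof.
have v1 : v 1 != 0 by rewrite gt_eqF // absval_gt0 oner_eq0.
by apply: (mulfI v1); rewrite -(absvalM hv) !mulr1.
Qed.

Lemma absvalN x : v (- x) = v x.
Proof.
suff vN1 : v (- 1) = 1 by rewrite -mulN1r (absvalM hv) vN1 mul1r.
apply/eqP; rewrite -(@eqrXn2 _ 2) ?(absval_ge0 hv) //.
by rewrite expr2 -(absvalM hv) mulrNN mulr1 absval1 expr1n.
Qed.

Lemma absval_sum_le (I : Type) (s : seq I) (P : pred I) (F : I -> R) (B : K) :
  0 <= B -> (forall i, P i -> v (F i) <= B) -> v (\sum_(i <- s | P i) F i) <= B.
Proof.
move=> B0 FB; elim/big_ind: _ => [|x y hx hy|//]; first by rewrite absval0.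
by rewrite (le_trans (absvalD_le_max hv x y)) // ge_max hx hy.
Qed.

Lemma absval_sum_lt (I : Type) (s : seq I) (P : pred I) (F : I -> R) (B : K) :
  0 < B -> (forall i, P i -> v (F i) < B) -> v (\sum_(i <- s | P i) F i) < B.
Proof.
move=> B0 FB; elim/big_ind: _ => [|x y hx hy|//]; first by rewrite absval0.
by rewrite (le_lt_trans (absvalD_le_max hv x y)) // gt_max hx hy.
Qed.

Definition gauss r f : K := sup (range (fun n => v (f n) * r ^+ n)).

Lemma gauss_le r f B : (forall n, v (f n) * r ^+ n <= B) -> gauss r f <= B.
Proof.
move=> fB; apply: ge_sup => [|_ [n _ <-] //].
by exists (v (f 0%N) * r ^+ 0), 0%N.
Qed.

Lemma entire_le_gauss r f n : entire v f -> 0 < r ->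
  v (f n) * r ^+ n <= gauss r f.
Proof.
move=> ef r0; apply: ub_le_sup; last by exists n.
have : cvgn (fun n => v (f n) * r ^+ n).
  by apply/cvg_ex; exists 0; exact: ef.
move=> /cvg_seq_bounded[M [_ /(_ (M + 1))]]; rewrite ltrDl ltr01 => /(_ isT) h.
by exists (M + 1) => _ [k _ <-]; exact: le_trans (ler_norm _) (h k I).
Qed.

Lemma gauss_ge0 r f : entire v f -> 0 < r -> 0 <= gauss r f.
Proof.
move=> ef r0; apply: le_trans (entire_le_gauss 0 ef r0).
by rewrite mulr_ge0 ?(absval_ge0 hv) ?exprn_ge0 ?ltW.
Qed.

(** A bound at radius 2 r gives geometric decay at radius r. *)
Lemma bounded_entire f :
  (forall r, 0 < r -> exists B, forall n, v (f n) * r ^+ n <= B) -> entire v f.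
Proof.
move=> fB r r0; have [B hB] := fB (2 * r) (mulr_gt0 (ltr0Sn K 1) r0).
have half : `|2^-1 : K| < 1 by rewrite ger0_norm ?invr_ge0 // invf_lt1 // ltr1n.
apply: squeeze_cvgr (cvg_cst 0) (cvg_geometric B half).
near=> n; apply/andP; split.
  by rewrite mulr_ge0 ?(absval_ge0 hv) ?exprn_ge0 ?ltW.
rewrite /geometric /= exprVn ler_pdivlMr ?exprn_gt0 //.
by rewrite -mulrA -exprMn [r * 2]mulrC hB.
Unshelve. all: by end_near.
Qed.

Lemma absval_mul_le r f g n : entire v f -> entire v g -> 0 < r ->
  v ((f * g) n) * r ^+ n <= gauss r f * gauss r g.
Proof.
move=> ef eg r0; have rn0 := exprn_gt0 n r0.
rewrite -ler_pdivlMr //; apply: absval_sum_le => [|i _].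
  by rewrite divr_ge0 ?mulr_ge0 ?gauss_ge0 // ltW.
rewrite (absvalM hv) ler_pdivlMr //.
have -> : r ^+ n = r ^+ i * r ^+ (n - i) by rewrite -exprD subnKC // leq_ord.
rewrite mulrACA.
apply: ler_pM; rewrite ?entire_le_gauss // mulr_ge0 ?(absval_ge0 hv) //;
  by rewrite exprn_ge0 ?ltW.
Qed.

Lemma entireM f g : entire v f -> entire v g -> entire v (f * g).
Proof.
move=> ef eg; apply: bounded_entire => r r0.
by exists (gauss r f * gauss r g) => n; exact: absval_mul_le.
Qed.

Lemma entire1 : entire v (1 : powerseries R).
Proof. by rewrite -(rmorph1 (@poly_series R)); exact: entire_poly. Qed.

Lemma entireN f : entire v f -> entire v (- f).
Proof.
move=> ef; rewrite -mulN1r; apply: entireM => //.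
by rewrite -(rmorph1 (@poly_series R)) -rmorphN; exact: entire_poly.
Qed.

Lemma absval_add_le r f g n : entire v f -> entire v g -> 0 < r ->
  v ((f + g) n) * r ^+ n <= Num.max (gauss r f) (gauss r g).
Proof.
move=> ef eg r0; rewrite -ler_pdivlMr ?exprn_gt0 //.
rewrite (le_trans (absvalD_le_max hv _ _)) // ge_max.
by rewrite !ler_pdivlMr ?exprn_gt0 // !le_max !entire_le_gauss // orbT.
Qed.

Lemma entireD f g : entire v f -> entire v g -> entire v (f + g).
Proof.
move=> ef eg; apply: bounded_entire => r r0.
by exists (Num.max (gauss r f) (gauss r g)) => n; exact: absval_add_le.
Qed.

Lemma gaussD r f g : entire v f -> entire v g -> 0 < r ->
  gauss r (f + g) <= Num.max (gauss r f) (gauss r g).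
Proof. by move=> ef eg r0; apply: gauss_le => n; exact: absval_add_le. Qed.

Lemma gaussN r f : gauss r (- f) = gauss r f.
Proof.
rewrite /gauss (_ : (fun n => v ((- f) n) * r ^+ n) = fun n => v (f n) * r ^+ n) //.
by apply/funext => n; rewrite -[(- f) n]/(- (f n)) absvalN.
Qed.

Lemma gauss_mono r r' f : entire v f -> 0 < r -> r <= r' ->
  gauss r f <= gauss r' f.
Proof.
move=> ef r0 rr'; apply: gauss_le => n.
rewrite (le_trans _ (entire_le_gauss n ef (lt_le_trans r0 rr'))) //.
rewrite ler_wpM2l ?(absval_ge0 hv) // lerXn2r // nnegrE ltW //.
exact: lt_le_trans rr'.
Qed.

(** The terms tend to 0, so the supremum is a maximum; the least index that
    attains it singles out the dominant term in gaussM. *)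
Lemma gauss_attained r f : entire v f -> 0 < r ->
  exists i, v (f i) * r ^+ i = gauss r f /\
            forall j, (j < i)%N -> v (f j) * r ^+ j < gauss r f.
Proof.
move=> ef r0; pose a n := v (f n) * r ^+ n.
have a_le n : a n <= gauss r f by exact: entire_le_gauss.
have [i0 ai0] : exists i, a i == gauss r f.
  apply: contrapT => nex; have a_lt n : a n < gauss r f.
    by rewrite lt_neqAle a_le andbT; apply/negP => e; apply: nex; exists n.
  have a_ge0 n : 0 <= a n by rewrite mulr_ge0 ?(absval_ge0 hv) ?exprn_ge0 ?ltW.
  have g_gt0 : 0 < gauss r f := le_lt_trans (a_ge0 0%N) (a_lt 0%N).
  (* Otherwise the finitely many terms that exceed half of the supremum have a
     maximum below it, which bounds all terms. *)
  have g2 : 0 < gauss r f / 2 by rewrite divr_gt0.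
  have [N _ hN] := (cvgr0Pnorm_lt a).1 (ef r r0) _ g2.
  suff : gauss r f <= \big[Num.max/gauss r f / 2]_(n < N) a n.
    apply/negP; rewrite -ltNge; elim/big_ind: _ => [|x y hx hy|//].
      by rewrite ltr_pdivrMr // ltr_pMr // ltr1n.
    by rewrite gt_max hx hy.
  apply: gauss_le => n; have [ltnN|leNn] := ltnP n N.
    exact: (le_bigmax _ (fun i : 'I_N => a i) (Ordinal ltnN)).
  apply: le_trans (bigmax_ge_id _ _ _ _).
  exact: le_trans (ler_norm _) (ltW (hN n leNn)).
have exP : exists i, a i == gauss r f by exists i0.
exists (ex_minn exP); case: ex_minnP => i /eqP ai min_i; split=> // j ltji.
rewrite lt_neqAle a_le andbT; apply/negP => /min_i.
by rewrite leqNgt ltji.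
Qed.

(** Gauss's lemma: if i and j are the least indices where f and g attain their
    norms, then f_i g_j strictly dominates the other terms in the coefficient
    of index i + j of f g. *)
Lemma gaussM r f g : entire v f -> entire v g -> 0 < r ->
  gauss r (f * g) = gauss r f * gauss r g.
Proof.
move=> ef eg r0; apply/eqP; rewrite eq_le; apply/andP; split.
  by apply: gauss_le => n; exact: absval_mul_le.
have [->|f_neq0] := eqVneq (gauss r f) 0.
  by rewrite mul0r gauss_ge0 //; exact: entireM.
have [->|g_neq0] := eqVneq (gauss r g) 0.
  by rewrite mulr0 gauss_ge0 //; exact: entireM.
have gf0 : 0 < gauss r f by rewrite lt_def f_neq0 gauss_ge0.
have gg0 : 0 < gauss r g by rewrite lt_def g_neq0 gauss_ge0.
have [i [fi fi_min]] := gauss_attained ef r0.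
have [j [gj gj_min]] := gauss_attained eg r0.
apply: le_trans (entire_le_gauss (i + j) (entireM ef eg) r0).
have rn0 := exprn_gt0 (i + j) r0; rewrite -ler_pdivrMr //.
have lt_i : (i < (i + j).+1)%N by rewrite ltnS leq_addr.
have -> : gauss r f * gauss r g / r ^+ (i + j) = v (f i * g j).
  by rewrite -fi -gj (absvalM hv) mulrACA -exprD mulfK ?gt_eqF.
(* If the whole coefficient were smaller than f_i g_j, then f_i g_j would be a
   difference of elements that are all smaller than itself. *)
rewrite leNgt; apply/negP => ltv; have vij : v (f i * g j) < v (f i * g j).
  have {1}-> : f i * g j = (f * g) (i + j)%N -
      \sum_(k < (i + j).+1 | k != Ordinal lt_i) f k * g (i + j - k)%N.
    by rewrite [(f * g) _](bigD1 (Ordinal lt_i)) //= addKn addrK.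
  apply: le_lt_trans (absvalD_le_max hv _ _) _; rewrite gt_max ltv /=.
  rewrite absvalN; apply: absval_sum_lt => [|k neq_ki].
    exact: le_lt_trans (absval_ge0 hv _) ltv.
  rewrite -(ltr_pM2r rn0) !(absvalM hv) [ltRHS](_ : _ = gauss r f * gauss r g).
    have {1}-> : r ^+ (i + j) = r ^+ k * r ^+ (i + j - k).
      by rewrite -exprD subnKC // leq_ord.
    rewrite mulrACA.
    have ltM (x y x' y' : K) : 0 <= x -> 0 < y' -> x < x' -> y <= y' ->
        x * y < x' * y'.
      move=> x0 y0 ltx ley; apply: le_lt_trans (ler_wpM2l x0 ley) _.
      by rewrite ltr_pM2r.
    have term_ge0 h n : 0 <= v (h n) * r ^+ n.
      by rewrite mulr_ge0 ?(absval_ge0 hv) ?exprn_ge0 ?ltW.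
    have [lt_ki|lt_ik|e] := ltngtP k i; last by case/eqP: neq_ki; exact: val_inj.
    - by apply: ltM => //; [exact: fi_min|exact: entire_le_gauss].
    rewrite mulrC [ltRHS]mulrC; apply: ltM => //.
    - by apply: gj_min; have := leq_ord k; lia.
    - exact: entire_le_gauss.
  by rewrite exprD mulrACA fi gj.
by rewrite ltxx in vij.
Qed.

End GaussNorm.

(** * Entire solutions of A^2 - c t A B + B^2 = 1 *)

Section EntireSolutions.
Variables (K : realType) (R : idomainType) (v : R -> K).
Hypothesis hv : nonarch_absval v.
Variable c : R.
Hypothesis c_neq0 : c != 0.

Let tau : powerseries R := poly_series (c%:P * 'X).

Lemma gauss1 r : 0 < r -> gauss v r (1 : powerseries R) = 1.
Proof.
move=> r0; have e1 := entire1 hv.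
apply/eqP; rewrite eq_le; apply/andP; split; last first.
  by have := entire_le_gauss 0 e1 r0; rewrite expr0 mulr1 (absval1 hv).
apply: gauss_le => -[|n]; first by rewrite expr0 mulr1 (absval1 hv).
by rewrite (_ : (1 : powerseries R) n.+1 = 0) // (absval0 hv) mul0r ler01.
Qed.

Lemma gauss_tau r f : entire v f -> 0 < r ->
  gauss v r (tau * f) = v c * r * gauss v r f.
Proof.
move=> ef r0; have etau : entire v tau by exact: entire_poly.
rewrite gaussM //; congr (_ * _).
have tauE n : tau n = if n == 1%N then c else 0.
  by rewrite /tau /poly_series coefCM coefX; case: eqP; rewrite ?mulr1 ?mulr0.
apply/eqP; rewrite eq_le; apply/andP; split; last first.
  by have := entire_le_gauss 1 etau r0; rewrite tauE expr1.
apply: gauss_le => n; rewrite tauE; case: eqP => [->|_]; first by rewrite expr1.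
by rewrite (absval0 hv) mul0r mulr_ge0 ?(absval_ge0 hv) // ltW.
Qed.

(** The Cauchy estimate |f_k| <= r^-k for all large r: Liouville's theorem. *)
Lemma gauss_le1_const r0 (f : powerseries R) : entire v f -> 0 < r0 ->
  (forall r, r0 <= r -> gauss v r f <= 1) -> f = poly_series (f 0%N)%:P.
Proof.
move=> ef r0_gt0 f_le1; apply/funext => -[|n]; rewrite /poly_series coefC //=.
apply/eqP; apply: contraT; rewrite -(absval_gt0 hv) => vn.
pose r := Num.max (Num.max r0 1) (2 / v (f n.+1)).
have r0r : r0 <= r by rewrite !le_max lexx.
have r1 : 1 <= r by rewrite !le_max lexx orbT.
have r2 : 2 <= v (f n.+1) * r by rewrite mulrC -ler_pdivrMr // !le_max lexx !orbT.
have r_gt0 : 0 < r by exact: lt_le_trans r0r.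
have := le_trans (entire_le_gauss n.+1 ef r_gt0) (f_le1 r r0r).
rewrite leNgt => /negP[]; rewrite (lt_le_trans (ltr1n K 2)) // (le_trans r2) //.
by rewrite ler_wpM2l ?(ltW vn) // exprS ler_peMr ?(ltW r_gt0) // exprn_ege1.
Qed.

Section Sequence.
Variable C : int -> powerseries R.
Hypotheses (C_rec : chebyshev_rec tau C) (C_entire : forall n, entire v (C n)).
Hypothesis C_norm : C 0 ^+ 2 - tau * C 0 * C 1 + C 1 ^+ 2 = 1.

Lemma sequence_mul n : C (n - 1) * C (n + 1) = C n ^+ 2 - 1.
Proof.
by rewrite -C_norm -(chebyshev_rec_norm n C_rec) (chebyshev_recP n C_rec); ring.
Qed.

Let small r n := gauss v r (C n) <= 1 /\ gauss v r (C (n + 1)) <= 1.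

Lemma sequence_small r : 0 < r -> 1 < v c * r ->
  (exists n, small r n) /\
  (forall m n, small r m -> small r n -> n <= m + 1).
Proof.
move=> r0 s1; pose g n := gauss v r (C n).
have g_ge0 n : 0 <= g n by exact: gauss_ge0.
have e1 := entire1 hv.
have eM := entireM hv.
have eN := entireN hv.
have g_convex n : v c * r * g n <= Num.max (g (n - 1)) (g (n + 1)).
  by rewrite -gauss_tau // -C_rec addrC; exact: gaussD.
have g_mul n : g (n - 1) * g (n + 1) <= Num.max (g n ^+ 2) 1.
  rewrite /g -(gaussM hv) // sequence_mul -[X in Num.max _ X](gauss1 r0).
  rewrite [gauss _ _ _ ^+ 2]expr2 -(gaussM hv) // -expr2.
  rewrite -[X in Num.max _ X](gaussN hv).
  by apply: gaussD => //; [rewrite expr2; exact: eM|exact: eN].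
have g_unit n : 1 <= Num.max (g n ^+ 2) (g (n - 1) * g (n + 1)).
  rewrite /g -[leLHS](gauss1 r0) expr2 -!(gaussM hv) // -[X in Num.max _ X](gaussN hv).
  rewrite [X in gauss v r X <= _](_ : 1 = C n * C n - C (n - 1) * C (n + 1)).
    by apply: gaussD => //; [exact: eM|apply: eN; exact: eM].
  by rewrite sequence_mul; ring.
split; first exact: (growth_le1_exists s1 g_ge0 g_convex g_mul).
by move=> m n [? ?] [? ?]; exact: (growth_le1_close s1 g_ge0 g_convex g_unit).
Qed.

(** If each of the three indices around the one found at r0 failed at some
    radius, all of them would fail at the largest of these radii, where
    nevertheless some index works, and works at r0 as well. *)
Lemma sequence_uniformly_small : exists r0 n, 0 < r0 /\
  forall r, r0 <= r -> small r n.
Proof.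
have vc : 0 < v c by rewrite (absval_gt0 hv).
pose r0 := 2 / v c; have r0_gt0 : 0 < r0 by rewrite divr_gt0.
have s_gt1 r : r0 <= r -> 1 < v c * r.
  move=> r0r; rewrite (lt_le_trans (ltr1n K 2)) // mulrC -ler_pdivrMr //.
have gt0 r : r0 <= r -> 0 < r by exact: lt_le_trans.
have mono r r' n : r0 <= r -> r <= r' -> small r' n -> small r n.
  by move=> /gt0 r_gt0 rr' [h h']; split; apply: le_trans (gauss_mono hv _ r_gt0 rr') _.
have [[m0 m0_small] close] := sequence_small r0_gt0 (s_gt1 _ (lexx _)).
apply: contrapT => nex.
have bad n : exists r, r0 <= r /\ ~ small r n.
  apply: contrapT => nbad; apply: nex; exists r0, n; split=> // r r0r.
  by apply: contrapT => nsm; apply: nbad; exists r.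
have [r1 [le1 bad1]] := bad (m0 - 1).
have [r2 [le2 bad2]] := bad m0.
have [r3 [le3 bad3]] := bad (m0 + 1).
pose r := Num.max r1 (Num.max r2 r3).
have r1r : r1 <= r by rewrite le_max lexx.
have r2r : r2 <= r by rewrite !le_max lexx orbT.
have r3r : r3 <= r by rewrite !le_max lexx !orbT.
have r0r := le_trans le1 r1r.
have [[n n_small] _] := sequence_small (gt0 _ r0r) (s_gt1 _ r0r).
have n_small0 := mono _ _ _ (lexx r0) r0r n_small.
have le_n := close _ _ m0_small n_small0.
have le_m := close _ _ n_small0 m0_small.
have : n = m0 - 1 \/ n = m0 \/ n = m0 + 1 by lia.
case=> [e|[e|e]]; move: n_small; rewrite e.
- by move/(mono _ _ _ le1 r1r).
- by move/(mono _ _ _ le2 r2r).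
- by move/(mono _ _ _ le3 r3r).
Qed.

(** Two consecutive terms are constants a, b with a b = 0.  If it is b that
    vanishes, the recurrence gives - a as the term after it. *)
Lemma sequence_has_unit :
  exists n, C n = 0 /\ (C (n + 1) = 1 \/ C (n + 1) = - 1).
Proof.
have [r0 [n [r0_gt0 n_small]]] := sequence_uniformly_small.
have := gauss_le1_const (C_entire n) r0_gt0 (fun r h => (n_small r h).1).
have := gauss_le1_const (C_entire (n + 1)) r0_gt0 (fun r h => (n_small r h).2).
move: (C n 0%N) (C (n + 1) 0%N) => a b eb ea.
have abE : a%:P ^+ 2 - c%:P * 'X * a%:P * b%:P + b%:P ^+ 2 = 1.
  apply: (@poly_series_inj R); rewrite rmorph1 -C_norm.
  rewrite -(chebyshev_rec_norm n C_rec) ea eb /tau.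
  by rewrite !(rmorphD, rmorphN, rmorphXn, rmorphM).
have ab0 : a * b = 0.
  have := congr1 (fun p : {poly R} => p`_1) abE.
  rewrite -!polyC_exp coefD coefB !coefC coefMC coefMC coefCM coefX /=.
  rewrite mulr1 sub0r addr0 => /eqP; rewrite oppr_eq0 -mulrA mulf_eq0.
  by rewrite (negPf c_neq0) => /eqP.
have ab1 : a ^+ 2 + b ^+ 2 = 1.
  have := congr1 (fun p : {poly R} => p`_0) abE.
  rewrite -!polyC_exp coefD coefB !coefC coefMC coefMC coefCM coefX /=.
  by rewrite mulr0 !mul0r subr0.
have sq1 (x : R) : x ^+ 2 = 1 ->
    poly_series x%:P = 1 \/ poly_series x%:P = - 1.
  move=> /eqP; rewrite sqrf_eq1 => /orP[]/eqP->; [left|right];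
    by rewrite ?polyCN ?rmorphN !rmorph1.
have series0 : poly_series (0 : R)%:P = 0 by rewrite polyC0 rmorph0.
have [a0|a_neq0] := eqVneq a 0.
  exists n; rewrite ea eb a0 series0; split=> //; apply: sq1.
  by rewrite -ab1 a0 expr0n add0r.
have b0 : b = 0.
  by apply/eqP; move/eqP: ab0; rewrite mulf_eq0 (negPf a_neq0).
exists (n + 1); rewrite (chebyshev_recS n C_rec) ea eb b0 series0 mulr0 sub0r.
split=> //; have [|->|->] := sq1 a; first by rewrite -ab1 b0 expr0n addr0.
  by right.
by left; rewrite opprK.
Qed.

End Sequence.

(** The sequence B U_n - A U_(n-1) takes the values A and B at 0 and 1; its
    zero term followed by 1 or -1 identifies it with a shift of U or of - U. *)
Lemma entire_norm_form (U : int -> {poly R}) (A B : powerseries R) :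
  chebyshev_rec (c%:P * 'X) U -> U 0 = 0 -> U 1 = 1 ->
  entire v A -> entire v B -> A ^+ 2 - tau * A * B + B ^+ 2 = 1 ->
  exists n, (A = poly_series (U (n - 1)) /\ B = poly_series (U n)) \/
    (A = - poly_series (U (n - 1)) /\ B = - poly_series (U n)).
Proof.
move=> rU U0 U1 eA eB AB.
pose V n := poly_series (U n).
have rV : chebyshev_rec tau V.
  by move=> n; rewrite /V -rmorphD rU rmorphM.
have V0 : V 0 = 0 by rewrite /V U0 rmorph0.
have V1 : V 1 = 1 by rewrite /V U1 rmorph1.
have VN1 : V (-1) = - 1.
  by have := chebyshev_recP 0 rV; rewrite !add0r V0 V1 mulr0 sub0r.
pose C n := B * V n + - A * V (n - 1).
have rC : chebyshev_rec tau C.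
  by apply: chebyshev_rec_comb => //; exact: chebyshev_rec_shift.
have C0 : C 0 = A by rewrite /C add0r V0 VN1 mulr0 add0r mulrNN mulr1.
have C1 : C 1 = B by rewrite /C subrr V0 V1 mulr0 mulr1 addr0.
have eC n : entire v (C n).
  apply: entireD => //; apply: entireM => //; try exact: entire_poly.
  exact: entireN.
have [|m [Cm0 Cm1]] := sequence_has_unit rC eC; first by rewrite C0 C1.
have CE e : C (m + 1) = e -> forall n, C n = e * V (n - m).
  move=> Ce n; have rCm := chebyshev_rec_shift m rC.
  have reV := chebyshev_rec_comb e 0 rV rV.
  have /= := chebyshev_rec_uniq rCm reV.
  rewrite !add0r V0 V1 !mul0r !addr0 mulr0 mulr1 [1 + m]addrC => /(_ Cm0 Ce).
  by move=> /(_ (n - m)) /=; rewrite subrK mul0r addr0.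
exists (1 - m); rewrite -[A]C0 -[B]C1 -/(V _) (addrAC 1) subrr add0r.
by case: Cm1 => /CE E; [left|right]; rewrite !E ?mul1r ?mulN1r add0r.
Qed.

End EntireSolutions.

(** * Coordinates of the powers of a unit of norm 1 *)

Section QuadraticCoordinates.
Variables (A : comNzRingType) (h : {poly A}).
Hypotheses (h_monic : h \is monic) (sz_h : size h = 3%N).
Variables (tau : A) (u : adjoin_root h).
Hypotheses (u_unit : u \is a GRing.unit)
  (u_root : u ^+ 2 + 1 = ar_const h tau * u).

Lemma unit_powers_rec : chebyshev_rec (ar_const h tau) (exprz u).
Proof.
move=> n; have e k : u ^ (k + 1) = u ^ k * u by rewrite exprzDr // expr1z.
have e0 : u ^ n = u ^ (n - 1) * u by rewrite -e subrK.
rewrite e e0.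
transitivity (u ^ (n - 1) * (u ^+ 2 + 1)); first by ring.
by rewrite u_root; ring.
Qed.

Lemma coord_rec : chebyshev_rec tau (fun n => ar_coord 0 (u ^ n)) /\
  chebyshev_rec tau (fun n => ar_coord 1 (u ^ n)).
Proof.
suff H n : tau * ar_coord 0 (u ^ n) =
             ar_coord 0 (u ^ (n + 1)) + ar_coord 0 (u ^ (n - 1)) /\
           tau * ar_coord 1 (u ^ n) =
             ar_coord 1 (u ^ (n + 1)) + ar_coord 1 (u ^ (n - 1)).
  by split=> n; case: (H n).
have := @ar_coord_unique A h h_monic sz_h (tau * ar_coord 0 (u ^ n))
  (tau * ar_coord 1 (u ^ n)) (u ^ (n + 1) + u ^ (n - 1)).
rewrite -!coefD; apply.
by rewrite unit_powers_rec -{3}(ar_decomp h_monic sz_h (u ^ n)) !rmorphM mulrDr mulrA.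
Qed.

End QuadraticCoordinates.

(** * The polynomials x_n and y_n *)

Section PellSequences.
Variable R : idomainType.

Lemma pell_unit_root : pell_unit R ^+ 2 + 1 =
  ar_const (pell_poly R) (2%:P * 'X) * pell_unit R.
Proof.
rewrite /pell_unit rmorphM polyC_natr rmorph_nat.
transitivity (ar_const (pell_poly R) 'X ^+ 2 + ar_root (pell_poly R) ^+ 2 + 1
  + 2 * ar_const (pell_poly R) 'X * ar_root (pell_poly R)); first by ring.
by rewrite pell_rootE rmorphB rmorphXn rmorph1; ring.
Qed.

Let unit_coord (x y : {poly R}) n :
  ar_const (pell_poly R) x + ar_const (pell_poly R) y * ar_root (pell_poly R)
  = pell_unit R ^ n -> pell_x R n = x /\ pell_y R n = y.
Proof.
move=> e.
have [-> ->] := ar_coord_unique (pell_poly_monic R) (pell_poly_size R) e.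
by [].
Qed.

Lemma pell_rec : chebyshev_rec (2%:P * 'X) (pell_x R) /\
  chebyshev_rec (2%:P * 'X) (pell_y R).
Proof.
exact (coord_rec (pell_poly_monic R) (pell_poly_size R) (pell_unitP R)
  pell_unit_root).
Qed.

Lemma pell_init0 : pell_x R 0 = 1 /\ pell_y R 0 = 0.
Proof. by apply: unit_coord; rewrite rmorph0 rmorph1 mul0r addr0 expr0z. Qed.

Lemma pell_init1 : pell_x R 1 = 'X /\ pell_y R 1 = 1.
Proof. by apply: unit_coord; rewrite rmorph1 mul1r expr1z. Qed.

Lemma pell_xE n : pell_x R n = 'X * pell_y R n - pell_y R (n - 1).
Proof.
have [rx ry] := pell_rec; have [x0 y0] := pell_init0.
have [x1 y1] := pell_init1.
have rD := chebyshev_rec_comb 'X (- 1) ry (chebyshev_rec_shift (- 1) ry).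
rewrite (chebyshev_rec_uniq rx rD) ?mulN1r //.
  by rewrite x0 y0 (chebyshev_recP 0 ry) add0r y0 y1 !mulr0 !sub0r opprK.
by rewrite x1 y1 subrr y0 mulr1 subr0.
Qed.

Lemma pell_xN n : pell_x R (- n) = pell_x R n.
Proof.
have [rx _] := pell_rec; have [x0 _] := pell_init0; have [x1 _] := pell_init1.
apply: (chebyshev_rec_uniq (chebyshev_rec_opp rx) rx) => //.
by have := chebyshev_recP 0 rx; rewrite !add0r => ->; rewrite x0 x1; ring.
Qed.

Lemma pell_yN n : pell_y R (- n) = - pell_y R n.
Proof.
have [_ ry] := pell_rec; have [_ y0] := pell_init0; have [_ y1] := pell_init1.
have rN := chebyshev_rec_comb (- 1) 0 ry ry.
rewrite (chebyshev_rec_uniq (chebyshev_rec_opp ry) rN) /=; first by ring.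
  by rewrite y0; ring.
by have := chebyshev_recP 0 ry; rewrite !add0r => ->; rewrite y0 y1; ring.
Qed.

(** x_n = t y_n - y_(n-1) turns the Pell form in (x_n, y_n) into the invariant
    of chebyshev_rec_norm at (y_(n-1), y_n). *)
Lemma pell_norm n : pell_x R n ^+ 2 - ('X^2 - 1) * pell_y R n ^+ 2 = 1.
Proof.
have [_ ry] := pell_rec; have [_ y0] := pell_init0; have [_ y1] := pell_init1.
have := chebyshev_rec_norm (n - 1) ry; rewrite subrK y0 y1 pell_xE.
rewrite mulr0 mul0r subr0 expr0n add0r expr1n => e.
by rewrite -[RHS]e polyC_natr; ring.
Qed.

Let unit2_coord (x y : {poly R}) n :
  ar_const (pell2_poly R) x + ar_const (pell2_poly R) y * pell2_root R
  = pell2_root R ^ n -> pell2_x R n = x /\ pell2_y R n = y.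
Proof.
move=> e.
have [-> ->] := ar_coord_unique (pell2_poly_monic R) (pell2_poly_size R) e.
by [].
Qed.

Lemma pell2_rec : chebyshev_rec ((-1)%:P * 'X) (pell2_x R) /\
  chebyshev_rec ((-1)%:P * 'X) (pell2_y R).
Proof.
apply: (coord_rec (pell2_poly_monic R) (pell2_poly_size R) (pell2_rootP R)).
apply/eqP; rewrite polyCN polyC1 mulN1r rmorphN mulNr -subr_eq0 opprK.
by rewrite addrAC pell2_rootE.
Qed.

Lemma pell2_init0 : pell2_x R 0 = 1 /\ pell2_y R 0 = 0.
Proof. by apply: unit2_coord; rewrite rmorph0 rmorph1 mul0r addr0 expr0z. Qed.

Lemma pell2_init1 : pell2_x R 1 = 0 /\ pell2_y R 1 = 1.
Proof. by apply: unit2_coord; rewrite rmorph0 rmorph1 mul1r add0r expr1z. Qed.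

Lemma pell2_xE n : pell2_x R n = - pell2_y R (n - 1).
Proof.
have [rx ry] := pell2_rec; have [x0 y0] := pell2_init0.
have [x1 y1] := pell2_init1.
have rD := chebyshev_rec_comb 0 (- 1) ry (chebyshev_rec_shift (- 1) ry).
rewrite (chebyshev_rec_uniq rx rD) ?mul0r ?add0r ?mulN1r //.
  by rewrite x0 (chebyshev_recP 0 ry) !add0r y0 y1 mulr0 sub0r opprK.
by apply: (eq_trans x1); rewrite subrr y0 oppr0.
Qed.

Lemma oppr_poly_pchar2 (p : {poly R}) : 2%N \in [pchar R] -> - p = p.
Proof. by move=> char2; apply/polyP => i; rewrite coefN GRing.oppr_pchar2. Qed.

Lemma pell2_norm n : 2%N \in [pchar R] ->
  pell2_x R n ^+ 2 + 'X * pell2_x R n * pell2_y R n + pell2_y R n ^+ 2 = 1.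
Proof.
move=> char2.
have [_ ry] := pell2_rec; have [_ y0] := pell2_init0; have [_ y1] := pell2_init1.
have := chebyshev_rec_norm (n - 1) ry; rewrite subrK y0 y1.
rewrite pell2_xE oppr_poly_pchar2 // polyCN polyC1 !mulN1r mulr0 mul0r subr0.
by rewrite expr0n add0r expr1n !mulNr opprK.
Qed.

(** The recurrence has integer coefficients. *)
Lemma prime_subring_rec (c : int) (U : int -> {poly R}) :
  chebyshev_rec (c%:~R%:P * 'X) U ->
  (forall i, prime_subring R (U 0)`_i) -> (forall i, prime_subring R (U 1)`_i) ->
  forall n i, prime_subring R (U n)`_i.
Proof.
move=> rU U0 U1.
apply: (@chebyshev_rec_ind _ _ U (fun p => forall i, prime_subring R p`_i) rU);
  move=> // p q hp hq i.
rewrite coefB -mulrA coefCM coefXM; move: (hq i).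
rewrite prime_subringE => -[b _ <-].
case: ifP => _; first by exists (- b); rewrite // mulr0 sub0r mulrNz.
have := hp i.-1; rewrite prime_subringE => -[a _ <-].
by exists (c * a - b); rewrite // intrB intrM.
Qed.

Lemma prime_subring_nat (n : nat) : prime_subring R n%:R.
Proof. by rewrite prime_subringE; exists n. Qed.

End PellSequences.

(** * The solutions of the two equations *)

Theorem theorem4p1 (K : realType) (R : idomainType) (v : R -> K)
    (hv : nonarch_absval v) :
  [/\ 2%N \notin [pchar R] ->
        forall X Y : powerseries R,
          [/\ entire v X, entire v Y &
              X ^+ 2 - poly_series ('X^2 - 1) * Y ^+ 2 = 1] <->
          exists n : int,
            (X = poly_series (pell_x R n) \/ X = poly_series (- pell_x R n)) /\
            Y = poly_series (pell_y R n),
      2%N \in [pchar R] ->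
        forall X Y : powerseries R,
          [/\ entire v X, entire v Y &
              X ^+ 2 + poly_series 'X * X * Y + Y ^+ 2 = 1] <->
          exists n : int,
            X = poly_series (pell2_x R n) /\ Y = poly_series (pell2_y R n),
      2%N \notin [pchar R] ->
        forall (n : int) (i : nat),
          prime_subring R (pell_x R n)`_i /\ prime_subring R (pell_y R n)`_i
    & 2%N \in [pchar R] ->
        forall (n : int) (i : nat),
          prime_subring R (pell2_x R n)`_i /\ prime_subring R (pell2_y R n)`_i].
Proof.
split.
- move=> char2 X Y; split=> [[eX eY XY]|[n [Xn ->]]]; last first.
    split; [by case: Xn => ->; exact: entire_poly|exact: entire_poly|].
    have -> : X ^+ 2 = poly_series (pell_x R n ^+ 2).
      by case: Xn => ->; rewrite ?rmorphN ?sqrrN rmorphXn.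
    by rewrite -rmorphXn -rmorphM -rmorphB pell_norm rmorph1.
  have two_neq0 : 2 != 0 :> R by move: char2; rewrite inE.
  have [_ ry] := pell_rec R; have [_ y0] := pell_init0 R.
  have [_ y1] := pell_init1 R.
  have et : entire v (poly_series ('X : {poly R})) by exact: entire_poly.
  (* X + Y sqrt (t^2 - 1) = - A + Y u with A = t Y - X. *)
  have eA : entire v (poly_series 'X * Y - X).
    apply: entireD => //; first exact: entireM.
    exact: entireN.
  have XE : X = poly_series 'X * Y - (poly_series 'X * Y - X) by ring.
  have [|n [[An Yn]|[An Yn]]] := entire_norm_form hv two_neq0 ry y0 y1 eA eY.
  + rewrite -XY rmorphM polyC_natr rmorph_nat rmorphB rmorphXn rmorph1; ring.
  + exists n; split=> //; left.
    by rewrite XE An Yn pell_xE rmorphB rmorphM.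
  (* - (x_n, y_n) = (- x_(-n), y_(-n)). *)
  + exists (- n); rewrite pell_xN pell_yN; split; last by rewrite rmorphN.
    right; by rewrite XE An Yn pell_xE rmorphN rmorphB rmorphM; ring.
- move=> char2 X Y; split=> [[eX eY XY]|[n [-> ->]]]; last first.
    split; [exact: entire_poly|exact: entire_poly|].
    by rewrite -!rmorphXn -!rmorphM -!rmorphD pell2_norm // rmorph1.
  have [_ ry] := pell2_rec R; have [_ y0] := pell2_init0 R.
  have [_ y1] := pell2_init1 R.
  have one_neq0 : -1 != 0 :> R by rewrite oppr_eq0 oner_eq0.
  have [|n An] := entire_norm_form hv one_neq0 ry y0 y1 eX eY.
    by rewrite -XY polyCN polyC1 mulN1r rmorphN; ring.
  exists n; rewrite pell2_xE oppr_poly_pchar2 //.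
  by case: An => -[-> ->]; rewrite -?rmorphN ?oppr_poly_pchar2.
- move=> _ n i; have [rx ry] := pell_rec R.
  have [x0 y0] := pell_init0 R; have [x1 y1] := pell_init1 R.
  split; [apply: (@prime_subring_rec R 2 _ rx)|apply: (@prime_subring_rec R 2 _ ry)];
    move=> j; rewrite ?(x0, y0, x1, y1) ?(coef0, coef1, coefX);
    first [exact: (prime_subring_nat 0)|exact: prime_subring_nat].
move=> _ n i; have [rx ry] := pell2_rec R.
have [x0 y0] := pell2_init0 R; have [x1 y1] := pell2_init1 R.
split; [apply: (@prime_subring_rec R (-1) _ rx)|apply: (@prime_subring_rec R (-1) _ ry)];
  move=> j; rewrite ?(x0, y0, x1, y1) ?(coef0, coef1, coefX);
  first [exact: (prime_subring_nat 0)|exact: prime_subring_nat].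
Qed.
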